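(* Let $A,B$ be logically independent events and let $A||B$ denote the biconditional event $(AB)|(A\vee B)$. Given any (coherent) assessment $(x,y)\in[0,1]^2$ on $\{A,B\}$, the extension $z=P(A||B)$ is coherent (i.e. $(x,y,z)$ is a coherent assessment on $\{A,B,(AB)|(A\vee B)\}$) if and only if $z\in[z',z'']$, where $$z'=\max\{x+y-1,0\},\qquad z''=\begin{cases}\dfrac{\min\{x,y\}}{\max\{x,y\}},& \text{if } x>0\text{ or }y>0,\\[2mm] 1,&\text{if }x=0\text{ and }y=0.\end{cases}$$
   Context: Events are elements of a Boolean algebra with sure event $\Omega$ and impossible event $\emptyset$; $\overline{E}$ is negation, $EF$ is conjunction, and an event is identified with its $0/1$ indicator. $A,B$ are logically independent if $AB,\ A\overline B,\ \overline AB,\ \overline A\,\overline B$ are all $\neq\emptyset$. An unconditional event $E$ is identified with $E|\Omega$. Coherence (de Finetti). A real assessment $(p_1,\dots,p_n)$ on a finite family of conditional events $\{E_1|H_1,\dots,E_n|H_n\}$ ($H_i\neq\emptyset$) is coherent if for every nonempty $S\subseteq\{1,\dots,n\}$ and all real $s_i$ ($i\in S$), the set $D$ of values of the random gain $G=\sum_{i\in S}s_iH_i(E_i-p_i)$ on the constituents (nonimpossible atoms generated by the $E_i,H_i$) contained in $\bigvee_{i\in S}H_i$ satisfies $\min D\le0\le\max D$. *)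

(* Defs.v *)
From HB Require Import structures.
From mathcomp Require Import all_boot all_order all_algebra reals.
Set Implicit Arguments.
Unset Strict Implicit.
Unset Printing Implicit Defensive.
Import Order.TTheory GRing.Theory Num.Theory.
Local Open Scope ring_scope.

(* Events are the elements of a Boolean algebra [T : ctbDistrLatticeType d],
   with sure event [\top], impossible event [\bot], negation [~` E] and
   conjunction [E `&` F]. *)

Definition logically_independent (d : Order.disp_t)
    (T : ctbDistrLatticeType d) (A B : T) : Prop :=
  [/\ (A `&` B)%O != \bot%O, (A `&` ~` B)%O != \bot%O,
      (~` A `&` B)%O != \bot%O & (~` A `&` ~` B)%O != \bot%O].

(* The conditional event E|H. The requirement that H is not impossible is
   part of [coherent] below. *)
Record cond_event (d : Order.disp_t) (T : ctbDistrLatticeType d) :=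
  CondEvent { consequent : T; antecedent : T }.

Definition unconditional (d : Order.disp_t) (T : ctbDistrLatticeType d)
    (E : T) : cond_event T :=
  CondEvent E \top%O.

Definition biconditional (d : Order.disp_t) (T : ctbDistrLatticeType d)
    (A B : T) : cond_event T :=
  CondEvent (A `&` B)%O (A `|` B)%O.

(* The conjunction of the E_i, H_i or their negations prescribed by [e]
   (first component for E_i, second for H_i); it may be impossible. *)
Definition atom (d : Order.disp_t) (T : ctbDistrLatticeType d) (n : nat)
    (F : n.-tuple (cond_event T)) (e : {ffun 'I_n -> bool * bool}) : T :=
  (\meet_(i < n)
     ((if (e i).1 then consequent (tnth F i) else ~` consequent (tnth F i))
      `&`
      (if (e i).2 then antecedent (tnth F i) else ~` antecedent (tnth F i))))%O.

Definition constituents_within (d : Order.disp_t)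
    (T : ctbDistrLatticeType d) (n : nat) (F : n.-tuple (cond_event T))
    (S : {set 'I_n}) : seq T :=
  [seq C <- [seq atom F e | e : {ffun 'I_n -> bool * bool}]
     | (C != \bot%O) && (C <= \join_(i in S) antecedent (tnth F i))%O].

(* The value on the constituent C of the 0/1 indicator of E. A constituent
   entails either E or its negation, for each E in the generating family. *)
Definition indicator (R : realType) (d : Order.disp_t)
    (T : ctbDistrLatticeType d) (C E : T) : R :=
  (C <= E)%O%:R.

Definition gain (R : realType) (d : Order.disp_t)
    (T : ctbDistrLatticeType d) (n : nat) (F : n.-tuple (cond_event T))
    (p : n.-tuple R) (S : {set 'I_n}) (s : 'I_n -> R) (C : T) : R :=
  \sum_(i in S) s i * indicator R C (antecedent (tnth F i))
    * (indicator R C (consequent (tnth F i)) - tnth p i).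

Definition gain_values (R : realType) (d : Order.disp_t)
    (T : ctbDistrLatticeType d) (n : nat) (F : n.-tuple (cond_event T))
    (p : n.-tuple R) (S : {set 'I_n}) (s : 'I_n -> R) : seq R :=
  [seq gain F p S s C | C <- constituents_within F S].

(* Meaningful for nonempty D only (the empty sequence gets 0); [gain_values]
   is nonempty as soon as S is nonempty and the antecedents are possible. *)
Definition seq_min (R : realType) (D : seq R) : R :=
  \big[Num.min/head 0 D]_(g <- D) g.

Definition seq_max (R : realType) (D : seq R) : R :=
  \big[Num.max/head 0 D]_(g <- D) g.

Definition coherent (R : realType) (d : Order.disp_t)
    (T : ctbDistrLatticeType d) (n : nat) (F : n.-tuple (cond_event T))
    (p : n.-tuple R) : Prop :=
  (forall i : 'I_n, antecedent (tnth F i) != \bot%O) /\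
  forall (S : {set 'I_n}) (s : 'I_n -> R), S != set0 ->
    seq_min (gain_values F p S s) <= 0 <= seq_max (gain_values F p S s).

Definition lower_bound (R : realType) (x y : R) : R :=
  Num.max (x + y - 1) 0.

Definition upper_bound (R : realType) (x y : R) : R :=
  if (0 < x) || (0 < y) then Num.min x y / Num.max x y else 1.

(* Main.v *)
(* On the constituents, coded by the truth values of A and B, coherence says
   that no linear bet has a gain of one strict sign. By elimination, the point
   (x, y, z) makes every bet fair on average over the constituents exactly for
   weights proportional to
     AB : z (x + y),  A~B : x - z y,  ~AB : y - z x,  ~A~B : 1 + z - x - y,
   whose sum is 1 + z. Nonnegativity of these weights, with 0 <= z <= 1, is the
   announced interval; a negative weight yields a bet that wins surely. *)
Require Import Defs.
From HB Require Import structures.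
From mathcomp Require Import all_boot all_order all_algebra reals.
From mathcomp Require Import ring lra.
Set Implicit Arguments.
Unset Strict Implicit.
Unset Printing Implicit Defensive.
Import Order.TTheory Order.CTheory GRing.Theory Num.Theory.
Local Open Scope ring_scope.

(** * Extrema of finite sequences *)

Section SeqExtrema.
Variable R : realType.
Implicit Type D : seq R.

(** The fold starts from the head of [D], itself an entry; for empty [D] it would return the default
    0. *)
Lemma seq_min_mem D : D != [::] -> seq_min D \in D.
Proof.
move=> D0; rewrite /seq_min big_seq; apply: (big_ind (fun v => v \in D)) => //.
  by case: D D0 => //= g D _; rewrite mem_head.
by move=> u v uD vD; rewrite /Num.min; case: ifP.
Qed.

Lemma seq_min_le D g : g \in D -> seq_min D <= g.
Proof. by move=> gD; exact: (ge_bigmin_seq _ g xpredT id). Qed.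

Lemma le_seq_max D g : g \in D -> g <= seq_max D.
Proof. by move=> gD; exact: (le_bigmax_seq _ g xpredT id). Qed.

End SeqExtrema.

(** * Truth values on constituents, and coherence as a one-sided condition *)

Section Coherence.
Variables (R : realType) (d : Order.disp_t) (T : ctbDistrLatticeType d).
Implicit Types C K E : T.

(** [C] settles the truth value of [E], as a constituent does for every generating event. *)
Definition decides C E := (C <= E)%O || (C <= ~` E)%O.

Lemma le_complF C E : C != \bot%O -> (C <= ~` E)%O -> (C <= E)%O = false.
Proof.
move=> C0 CE; apply/negP => CE'; move/negP: C0; apply.
by rewrite -lex0 -(meetxC E) lexI CE' CE.
Qed.

(** A truth value settled on [K] persists on every possible event below [K], so it can be read off
    there. *)
Lemma decides_le C K E :
  C != \bot%O -> (C <= K)%O -> decides K E -> (C <= E)%O = (K <= E)%O.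
Proof.
move=> C0 CK /orP[KE | KE]; first by rewrite KE (le_trans CK KE).
have K0 : K != \bot%O by apply: contraNneq C0 => K0; rewrite -lex0 -K0.
by rewrite (le_complF K0 KE) (le_complF C0 (le_trans CK KE)).
Qed.

Lemma decides_if C E (b : bool) :
  (C <= if b then E else ~` E)%O -> decides C E.
Proof. by rewrite /decides; case: b => ->; rewrite ?orbT. Qed.

Lemma decidesI C E F : decides C E -> decides C F -> decides C (E `&` F)%O.
Proof.
rewrite /decides lexI complI => /orP[-> | CE] => [|_].
  by case/orP=> [-> // | CF]; rewrite (le_trans CF (leUr _ _)) orbT.
by rewrite (le_trans CE (leUl _ _)) orbT.
Qed.

Lemma decides_compl C E : decides C (~` E)%O = decides C E.
Proof. by rewrite /decides complK orbC. Qed.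

Lemma decidesU C E F : decides C E -> decides C F -> decides C (E `|` F)%O.
Proof.
by move=> CE CF; rewrite -decides_compl complU decidesI ?decides_compl.
Qed.

Lemma decides_leU C E F : C != \bot%O -> decides C E -> decides C F ->
  (C <= E `|` F)%O = (C <= E)%O || (C <= F)%O.
Proof.
move=> C0 /orP[CE _ | CE /orP[CF | CF]]; first by rewrite CE lexUl.
  by rewrite CF orbT lexUr.
have CEF : (C <= ~` (E `|` F))%O by rewrite complU lexI CE.
by rewrite (le_complF C0 CE) (le_complF C0 CF) (le_complF C0 CEF).
Qed.

Variable n : nat.
Variable F : n.-tuple (cond_event T).

Lemma constituents_withinP (S : {set 'I_n}) C :
  C \in constituents_within F S ->
  [/\ C != \bot%O, (C <= \join_(i in S) antecedent (tnth F i))%O,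
      forall i, decides C (consequent (tnth F i))
    & forall i, decides C (antecedent (tnth F i))].
Proof.
rewrite mem_filter => /andP[/andP[C0 CS] /imageP[e _ Ce]].
split=> // i; move: (lexx C); rewrite {2}Ce => /meetsP/(_ i isT).
  by rewrite lexI => /andP[/decides_if].
by rewrite lexI => /andP[_ /decides_if].
Qed.

(** The truth values taken on [K] select an atom above [K]. It is possible because [K] is, and it
    entails the antecedent of index [i] because that antecedent is one of its factors. *)
Lemma constituent_ge (S : {set 'I_n}) K : K != \bot%O ->
  (forall i, decides K (consequent (tnth F i))) ->
  (forall i, decides K (antecedent (tnth F i))) ->
  (exists2 i, i \in S & (K <= antecedent (tnth F i))%O) ->
  exists2 C, C \in constituents_within F S & (K <= C)%O.
Proof.
move=> K0 KE KH [i iS Ki].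
pose e : {ffun 'I_n -> bool * bool} := [ffun j =>
  ((K <= consequent (tnth F j))%O, (K <= antecedent (tnth F j))%O)].
have Ke : (K <= atom F e)%O.
  apply/meetsP => j _; rewrite ffunE lexI /=; apply/andP; split.
    by move: (KE j); rewrite /decides; case: ifP.
  by move: (KH j); rewrite /decides; case: ifP.
exists (atom F e) => //; rewrite mem_filter image_f // andbT; apply/andP; split.
  by apply: contraNneq K0 => K0; rewrite -lex0 -K0.
apply: le_trans (joins_sup _ iS).
rewrite (le_trans (@meets_inf _ _ _ i xpredT _ isT)) //.
by rewrite ffunE Ki leIxr // leIr.
Qed.

Lemma gainN (p : n.-tuple R) (S : {set 'I_n}) (s : 'I_n -> R) C :
  gain F p S (fun i => - s i) C = - gain F p S s C.
Proof. by rewrite /gain -sumrN; apply: eq_bigr => i _; rewrite !mulNr. Qed.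

(* Negating the stakes exchanges the two inequalities, so one suffices. *)
Lemma coherentP (p : n.-tuple R) :
  (forall S : {set 'I_n}, S != set0 -> constituents_within F S != [::]) ->
  coherent F p <->
  (forall i, antecedent (tnth F i) != \bot%O) /\
  forall (S : {set 'I_n}) (s : 'I_n -> R), S != set0 ->
    exists2 C, C \in constituents_within F S & gain F p S s C <= 0.
Proof.
move=> nonempty; split=> -[F0 coh]; split=> // S s S0.
  have /andP[] := coh S s S0; set D := gain_values F p S s => minD _.
  have D0 : D != [::].
    by rewrite -size_eq0 size_map size_eq0 nonempty.
  have /mapP[C CS eqC] := seq_min_mem D0.
  by exists C; rewrite // -eqC.
have [C CS gC] := coh S s S0.
have [C' C'S] := coh S (fun i => - s i) S0; rewrite gainN oppr_le0 => gC'.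
apply/andP; split; first by apply: le_trans gC; exact/seq_min_le/map_f.
by apply: (le_trans gC'); exact/le_seq_max/map_f.
Qed.

End Coherence.

(** * Bets on A, B and A||B *)

Section Biconditional.
Variables (R : realType) (d : Order.disp_t) (T : ctbDistrLatticeType d).
Variables (A B : T) (x y z : R).
Hypothesis hAB : logically_independent A B.

Let F := [tuple unconditional A; unconditional B; biconditional A B].
Let p := [tuple x; y; z].
Implicit Types (C : T) (S : {set 'I_3}).

Definition quadrant (a b : bool) : T :=
  ((if a then A else ~` A) `&` (if b then B else ~` B))%O.

(** The factor [(a || b)%:R] calls off the bet on A||B when A and B both fail. *)
Definition bet_gain (s0 s1 s2 : R) (a b : bool) : R :=
  s0 * (a%:R - x) + s1 * (b%:R - y) + s2 * (a || b)%:R * ((a && b)%:R - z).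

Lemma quadrant_neq0 a b : quadrant a b != \bot%O.
Proof. by case: hAB; case: a b => -[]. Qed.

Lemma decides_quadrant a b : decides (quadrant a b) A /\ decides (quadrant a b) B.
Proof.
split; first by apply: (@decides_if _ _ _ _ a); apply: leIl.
by apply: (@decides_if _ _ _ _ b); apply: leIr.
Qed.

Lemma quadrant_le a b :
  (quadrant a b <= A)%O = a /\ (quadrant a b <= B)%O = b.
Proof.
have qA : (quadrant a b <= if a then A else ~` A)%O by apply: leIl.
have qB : (quadrant a b <= if b then B else ~` B)%O by apply: leIr.
have q0 := quadrant_neq0 a b.
split; first by case: a qA q0 {qB} => // qA q0; apply: le_complF.
by case: b qB q0 {qA} => // qB q0; apply: le_complF.
Qed.

Lemma decides_family C : decides C A -> decides C B ->
  (forall i, decides C (consequent (tnth F i))) /\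
  (forall i, decides C (antecedent (tnth F i))).
Proof.
move=> CA CB; have C1 : decides C \top%O by rewrite /decides lex1.
split; case=> -[|[|[|i]]] //= lti.
  exact: decidesI.
exact: decidesU.
Qed.

(** Giving stake 0 to the indices outside [S] turns a bet on any subfamily into a bet on all three
    events. *)
Lemma gain_bet S (s : 'I_3 -> R) C : C != \bot%O -> decides C A -> decides C B ->
  let st i := if i \in S then s i else 0 in
  gain F p S s C =
    bet_gain (st 0) (st 1) (st 2) (C <= A)%O (C <= B)%O.
Proof.
move=> C0 CA CB st; rewrite /gain big_mkcond /= !big_ord_recl big_ord0 addr0.
rewrite /indicator /= lex1 lexI decides_leU // /bet_gain /st addrA.
have -> : lift ord0 ord0 = 1 :> 'I_3 by apply: val_inj.
have -> : lift ord0 (lift ord0 ord0) = 2 :> 'I_3 by apply: val_inj.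
by case: ifP; case: ifP; case: ifP; rewrite ?mul0r ?mulr1.
Qed.

(** Indices 0 and 1 have the sure event as antecedent, so either of them admits all four quadrants;
    for [S] reduced to index 2, ~A~B is excluded. A constituent above the quadrant has the same
    truth values, so the two need not be identified. *)
Lemma constituent_quadrant S a b :
  (if a || b then S != set0 else (0 \in S) || (1 \in S)) ->
  exists C, [/\ C \in constituents_within F S, (C <= A)%O = a & (C <= B)%O = b].
Proof.
move=> abS; have [qA qB] := decides_quadrant a b.
have [qE qH] := decides_family qA qB.
have [leA leB] := quadrant_le a b.
have q0 := quadrant_neq0 a b.
have [|C CS Cq] := constituent_ge (S := S) q0 qE qH.
  case: ifP abS => [ab /set0Pn[i iS] | _ /orP[] iS].
  - exists i => //; case: i {iS} => -[|[|[|i]]] lti //=; rewrite ?lex1 //.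
    by rewrite decides_leU ?leA ?leB.
  - by exists 0; rewrite //= lex1.
  - by exists 1; rewrite //= lex1.
exists C; have [_ _ CE _] := constituents_withinP CS.
by rewrite -(decides_le q0 Cq (CE 0)) -(decides_le q0 Cq (CE 1)).
Qed.

(* The condition 0 <= z <= 1 comes from the bets on the biconditional alone,
   whose gain is only considered on A \/ B. *)
Lemma coherent_biconditionalP :
  coherent F p <->
  0 <= z <= 1 /\
  forall s0 s1 s2 : R, exists a b, bet_gain s0 s1 s2 a b <= 0.
Proof.
have nonempty S : S != set0 -> constituents_within F S != [::].
  move=> S0; have [//|C [CS _ _]] := @constituent_quadrant S true true.
  by apply: contraTneq CS => ->.
have decAB S C : C \in constituents_within F S ->
    [/\ C != \bot%O, decides C A & decides C B].
  case/constituents_withinP=> C0 _ CE _; split=> //.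
    by have := CE 0.
  by have := CE 1.
rewrite coherentP //; split=> [[_ coh] | [/andP[z_ge0 z_le1] coh]].
  have bet2 c : exists a b, (a || b) && (c * ((a && b)%:R - z) <= 0).
    have S0 : [set 2 : 'I_3] != set0 by apply/set0Pn; exists 2; rewrite inE.
    have [C CS] := coh [set 2] (fun=> c) S0.
    have [C0 CA CB] := decAB _ _ CS.
    rewrite gain_bet // !inE /= /bet_gain !mul0r !add0r => gC.
    have [_ + _ _] := constituents_withinP CS.
    rewrite big_set1 /= decides_leU // => CAB.
    exists (C <= A)%O, (C <= B)%O.
    by move: gC; rewrite CAB mulr1.
  split=> [|s0 s1 s2].
    apply/andP; split.
      (* Stake 1 forces [0 <= z]; stake -1 below forces [z <= 1]. *)
      by have [a [b /andP[_]]] := bet2 1; case: (a && b) => /=; lra.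
    by have [a [b /andP[_]]] := bet2 (-1); case: (a && b) => /=; lra.
  have S0 : [set: 'I_3] != set0 by apply/set0Pn; exists 0; rewrite inE.
  have [C CS] := coh setT (fun i => nth 0 [:: s0; s1; s2] i) S0.
  have [C0 CA CB] := decAB _ _ CS.
  by rewrite gain_bet // !inE /= => gC; exists (C <= A)%O, (C <= B)%O.
split=> [|S s S0].
  have [q11 _ _ _] := hAB.
  have nz E : (A `&` B <= E)%O -> E != \bot%O.
    by move=> qE; apply: contraNneq q11 => E0; rewrite -lex0 -E0.
  case=> -[|[|[|i]]] //= lti.
  - by rewrite nz ?lex1.
  - by rewrite nz ?lex1.
  - by rewrite nz // lexU2 // leIl.
pose st i := if i \in S then s i else 0.
suff [a [b abS gab]] : exists a, exists2 b,
    (if a || b then S != set0 else (0 \in S) || (1 \in S)) &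
    bet_gain (st 0) (st 1) (st 2) a b <= 0.
  have [C [CS CA CB]] := constituent_quadrant abS.
  have [C0 dA dB] := decAB _ _ CS.
  by exists C; rewrite // gain_bet // CA CB.
have [S01 | /norP[S_0 S_1]] := boolP ((0 \in S) || (1 \in S)).
  have [a [b gab]] := coh (st 0) (st 1) (st 2).
  by exists a, b; rewrite // S0 if_same.
rewrite /st (negPf S_0) (negPf S_1) S0 /bet_gain.
(* Only the bet on A||B remains: A~B makes a nonnegative stake lose or break even, and AB does so
   for a negative one. *)
have [s2_ge0 | s2_lt0] := lerP 0 (st 2).
  by exists true, false => //=; rewrite -/(st 2); nra.
by exists true, true => //=; rewrite -/(st 2); nra.
Qed.

(** * From fair weights to the interval *)

Hypotheses (hx : 0 <= x <= 1) (hy : 0 <= y <= 1).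

Lemma bet_gain_le0P : 0 <= z <= 1 ->
  (forall s0 s1 s2 : R, exists a b, bet_gain s0 s1 s2 a b <= 0) <->
  [/\ z * y <= x, z * x <= y & x + y - 1 <= z].
Proof.
move=> /andP[z0 z1]; have /andP[x0 x1] := hx; have /andP[y0 y1] := hy.
split=> [bet | [zy zx xyz] s0 s1 s2].
  split.
  (* The gain is [z * y - x] on every quadrant except A~B, where it is larger by [1 + z]. A
     nonpositive gain somewhere thus gives the bound. The next bet exchanges A and B; the last gains
     [x + y - 1 - z], plus [1 + z] on ~A~B only. *)
  - have [a [b]] := bet 1 (- z) (-1).
    by rewrite /bet_gain; case: a b => -[] /=; nra.
  - have [a [b]] := bet (- z) 1 (-1).
    by rewrite /bet_gain; case: a b => -[] /=; nra.
  - have [a [b]] := bet (-1) (-1) 1.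
    by rewrite /bet_gain; case: a b => -[] /=; nra.
pose g := bet_gain s0 s1 s2.
have bary : z * (x + y) * g true true + (x - z * y) * g true false
    + (y - z * x) * g false true + (1 + z - x - y) * g false false = 0.
  by rewrite /g /bet_gain /=; ring.
have [|g11] := lerP (g true true) 0; first by exists true, true.
have [|g10] := lerP (g true false) 0; first by exists true, false.
have [|g01] := lerP (g false true) 0; first by exists false, true.
have [|g00] := lerP (g false false) 0; first by exists false, false.
(* Some weights may vanish, but their sum [1 + z] is positive. Replacing each gain by the least one
   bounds the weighted sum below by [(1 + z) * m > 0], contradicting [bary]. *)
pose m := Num.min (Num.min (g true true) (g true false))
                  (Num.min (g false true) (g false false)).
have m_gt0 : 0 < m by rewrite !lt_min g11 g10 g01 g00.
have le_wg w a b : 0 <= w -> w * m <= w * g a b.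
  move=> w0; rewrite ler_wpM2l // /m !ge_min.
  by case: a b => -[]; rewrite lexx ?orbT.
have w11 : 0 <= z * (x + y) by rewrite mulr_ge0 ?addr_ge0.
have w10 : 0 <= x - z * y by lra.
have w01 : 0 <= y - z * x by lra.
have w00 : 0 <= 1 + z - x - y by lra.
have : 0 < (1 + z) * m by rewrite mulr_gt0 // ltr_wpDr.
have := (le_wg _ true true w11, le_wg _ true false w10,
         le_wg _ false true w01, le_wg _ false false w00).
by move: bary => /[swap] -[[[]]]; lra.
Qed.

Lemma bounds_biconditionalP :
  lower_bound x y <= z <= upper_bound x y <->
  0 <= z <= 1 /\ [/\ z * y <= x, z * x <= y & x + y - 1 <= z].
Proof.
have /andP[x0 x1] := hx; have /andP[y0 y1] := hy.
rewrite /lower_bound /upper_bound ge_max -andbA.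
have [xy_gt0 | xy_le0] := boolP ((0 < x) || (0 < y)).
  have max_gt0 : 0 < Num.max x y by rewrite lt_max.
  (* Clearing the denominator gives z max(x, y) <= min(x, y), one of the two product inequalities.
     As the maximum is positive, this forces [z <= 1], which with [0 <= z] yields the other one. *)
  rewrite ler_pdivlMr //; have [xy | yx] := leP x y.
    split=> [/and3P[? ? ?] | [/andP[? ?] [? ? ?]]]; last by apply/and3P.
    by split; [apply/andP | ]; split=> //; nra.
  split=> [/and3P[? ? ?] | [/andP[? ?] [? ? ?]]]; last by apply/and3P.
  by split; [apply/andP | ]; split=> //; nra.
(* At x = y = 0 the product inequalities are trivial, and only [z <= 1] bounds [z] from above. *)
move: xy_le0; rewrite negb_or -!leNgt => /andP[x_le0 y_le0].
have -> : x = 0 by lra.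
have -> : y = 0 by lra.
rewrite !mulr0; split=> [/and3P[-> -> ->] // | [/andP[-> ->] [_ _ ->]] //].
Qed.

End Biconditional.

Theorem theorem8 (R : realType) (d : Order.disp_t)
    (T : ctbDistrLatticeType d) (A B : T)
    (hAB : logically_independent A B)
    (x y : R) (hx : 0 <= x <= 1) (hy : 0 <= y <= 1) (z : R) :
  coherent [tuple unconditional A; unconditional B; biconditional A B]
           [tuple x; y; z]
  <-> lower_bound x y <= z <= upper_bound x y.
Proof.
rewrite coherent_biconditionalP // bounds_biconditionalP //.
by split=> -[hz h]; split=> //; apply/(bet_gain_le0P hx hy hz).
Qed.
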